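(* Let $\rho>0$ satisfy $$\widehat M_1\|\ell\|_{V'}+\theta_\rho\,\rho\le\rho,\qquad q_\rho<1 ,$$ and let $0<h\le h_0$. Let $(u_1,u_2)$ be the unique solution in $\mathcal B_\rho:=\{(u,v)\in V\times V:\ \|u\|_V\le\rho,\ \|v\|_V\le\sigma_\rho\}$ of $$a_1(u_1,\xi)=\int_{B_R}\chi_1\overline{u_1}u_2\overline{\xi}\,dx+\ell(\xi)\quad\forall \xi\in V,\qquad a_2(u_2,\eta)=\int_{B_R}\chi_2u_1^2\overline{\eta}\,dx\quad\forall\eta\in V,$$ and let $(u_{1,h},u_{2,h})$ be the unique solution in $\mathcal B_{\rho,h}:=\{(u_h,v_h)\in V_h\times V_h:\ \|u_h\|_V\le\rho,\ \|v_h\|_V\le\sigma_\rho\}$ of $$a_1(u_{1,h},\xi_h)=\int_{B_R}\chi_1\overline{u_{1,h}}u_{2,h}\overline{\xi_h}\,dx+\ell(\xi_h)\quad\forall \xi_h\in V_h,\qquad a_2(u_{2,h},\eta_h)=\int_{B_R}\chi_2u_{1,h}^2\overline{\eta_h}\,dx\quad\forall\eta_h\in V_h.$$ Then $$\|u_1-u_{1,h}\|_V+\|u_2-u_{2,h}\|_V\le C_{\rm FE}\left(\inf_{z_h\in V_h}\|u_1-z_h\|_V+\inf_{w_h\in V_h}\|u_2-w_h\|_V\right),$$ where $$C_{\rm FE}:=C_{\rm qo}\left[1+\frac{(1+\beta_\rho)(1+\alpha_\rho)}{1-q_\rho}\right].$$ In particular, $C_{\rm FE}$ is independent of $h$.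
   Context: Setting. Let $d\in\{2,3\}$, let $D\subset\mathbb R^d$ be a bounded Lipschitz domain, and let $R>0$ be such that $\overline D\subset B_R$, where $B_R$ is the ball of radius $R$ centered at the origin, with boundary $\Gamma_R$ and outward unit normal $\nu$. Let $\kappa_1>0$ and $\kappa_2:=2\kappa_1$. For $j=1,2$ let $n_j\in L^\infty(B_R;\mathbb R)$ with $0<n_{\min}\le n_j\le n_{\max}<\infty$ a.e. and $n_j=1$ outside $\overline D$; let $\chi_j\in L^\infty(\mathbb R^d)$ be real-valued, nonnegative and supported in $\overline D$. Let $u^i(x)=\exp(i\kappa_1 d_0\cdot x)$ with $d_0\in\mathbb S^{d-1}$. Spaces. $V:=H^1(B_R;\mathbb C)$ with $\|\cdot\|_V:=\|\cdot\|_{H^1(B_R)}$; $V'$ is the anti-dual of $V$ (continuous conjugate-linear functionals, with the dual norm); $\gamma:V\to H^{1/2}(\Gamma_R)$ is the trace; $\langle\cdot,\cdot\rangle_{\Gamma_R}$ is the duality pairing of $H^{-1/2}(\Gamma_R)$ and $H^{1/2}(\Gamma_R)$, linear in the first and conjugate-linear in the second argument; $\langle F,v\rangle$ denotes the pairing of an anti-dual with its space, linear in $F$ and conjugate-linear in $v$. DtN map. For $k>0$ and $g\in H^{1/2}(\Gamma_R)$ let $w_g$ be the unique solution of $\Delta w_g+k^2w_g=0$ in $\mathbb R^d\setminus\overline{B_R}$, $w_g=g$ on $\Gamma_R$, satisfying the radiation condition $\lim_{r=|x|\to\infty}r^{(d-1)/2}(\partial_r w_g-ikw_g)=0$ uniformly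 in $x/|x|$. Set $T_kg:=\partial_\nu w_g|_{\Gamma_R}$; $T_k:H^{1/2}(\Gamma_R)\to H^{-1/2}(\Gamma_R)$ is bounded. Forms and data. For $j=1,2$, $a_j(w,\xi):=\int_{B_R}(\nabla w\cdot\nabla\overline\xi-\kappa_j^2n_jw\overline\xi)\,dx-\langle T_{\kappa_j}\gamma w,\gamma\xi\rangle_{\Gamma_R}$ on $V\times V$. The functional $\ell\in V'$ is $\ell(\xi):=\langle f_R,\gamma\xi\rangle_{\Gamma_R}$ with $f_R:=\partial_\nu u^i-T_{\kappa_1}(\gamma u^i)$. Continuous linear stability (known fact). For $j=1,2$ the operator $A_j:V\to V'$, $\langle A_jw,\phi\rangle:=a_j(w,\phi)$, is an isomorphism; $M_j>0$ is a constant with $\|A_j^{-1}g\|_V\le M_j\|g\|_{V'}$ for all $g\in V'$. Product constant. $C_{\rm prod}>0$ is a constant, depending only on $B_R$ and $d$, with $\|w\|_{L^4(B_R)}\|z\|_{L^4(B_R)}\|\phi\|_{L^2(B_R)}\le C_{\rm prod}\|w\|_V\|z\|_V\|\phi\|_V$ for all $w,z,\phi\in V$. Finite element spaces. $\{\mathcal T_h\}_{h>0}$ is a family of shape-regular conforming meshes of $B_R$ by triangles ($d=2$) or tetrahedra ($d=3$), curvilinear at $\Gamma_R$; $V_h\subset V$ is a (finite-dimensional) conforming space of piecewise polynomials of degree $p\ge1$ on $\mathcal T_h$, equipped with $\|\cdot\|_V$, with anti-dual $V_h'$ and its dual norm. The family is dense: $\inf_{z_h\in V_h}\|v-z_h\|_V\to0$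 as $h\to0$ for every $v\in V$. Discrete linear stability and quasi-optimality (known fact, fixing the constants). There are constants $h_0,M_{\rm lin},C_{\rm qo}>0$, independent of $h$, such that for $j=1,2$ and $0<h\le h_0$: (1) for every $g_h\in V_h'$ there is a unique $w_h\in V_h$ with $a_j(w_h,\phi_h)=\langle g_h,\phi_h\rangle$ for all $\phi_h\in V_h$, and $\|w_h\|_V\le M_{\rm lin}\|g_h\|_{V_h'}$; (2) if $g\in V'$, $w\in V$ solves $a_j(w,\phi)=\langle g,\phi\rangle$ for all $\phi\in V$, and $w_h\in V_h$ solves the problem in (1) with $g_h=g|_{V_h}$, then $\|w-w_h\|_V\le C_{\rm qo}\inf_{z_h\in V_h}\|w-z_h\|_V$. Derived constants. $\widehat M_j:=\max\{M_j,M_{\rm lin}\}$, and for $r>0$: $\alpha_r:=\widehat M_1C_{\rm prod}\|\chi_1\|_{L^\infty(B_R)}r$, $\beta_r:=2\widehat M_2C_{\rm prod}\|\chi_2\|_{L^\infty(B_R)}r$, $\sigma_r:=\beta_rr/2$, $\theta_r:=\widehat M_1C_{\rm prod}\|\chi_1\|_{L^\infty(B_R)}\sigma_r=\alpha_r\beta_r/2$, $q_r:=\theta_r+\alpha_r\beta_r=\tfrac32\alpha_r\beta_r$. Well-posedness. For $\rho$ with $\widehat M_1\|\ell\|_{V'}+\theta_\rho\rho\le\rho$ and $q_\rho<1$, and $0<h\le h_0$, the continuous and discrete nonlinear problems have unique solutions in $\mathcal B_\rho$ and $\mathcal B_{\rho,h}$ respectively. *)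

(* Defs.v *)
From HB Require Import structures.
From mathcomp Require Import all_boot all_order all_algebra.
From mathcomp Require Import all_classical all_reals all_analysis.
From mathcomp.real_closed Require Import complex.
Set Implicit Arguments.
Unset Strict Implicit.
Unset Printing Implicit Defensive.
Import Order.TTheory GRing.Theory Num.Theory numFieldNormedType.Exports.
Local Open Scope classical_set_scope.
Local Open Scope ring_scope.
Local Open Scope complex_scope.

Notation normc := ComplexField.Normc.normc.

(* The Borel sigma-algebra of R^d, generated by the coordinate maps.          *)
Section rV_measurable.
Context (R : realType) (d : nat).

Let coord (i : 'I_d) (x : 'rV[R]_d) : measurableTypeR R := x 0 i.

Let rV_set0 : g_sigma_preimage coord set0.
Proof. exact: sigma_algebra0. Qed.

Let rV_setC A : g_sigma_preimage coord A -> g_sigma_preimage coord (~` A).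
Proof. exact: sigma_algebraC. Qed.

Let rV_bigcup (F : _^nat) : (forall i, g_sigma_preimage coord (F i)) ->
  g_sigma_preimage coord (\bigcup_i (F i)).
Proof. exact: sigma_algebra_bigcup. Qed.

HB.instance Definition _ :=
  @isMeasurable.Build (measure_tuple_display default_measure_display)
    'rV[R]_d (g_sigma_preimage coord) rV_set0 rV_setC rV_bigcup.

Lemma measurable_coord (i : 'I_d) :
  measurable_fun [set: 'rV[R]_d] (fun x : 'rV[R]_d => x 0 i : measurableTypeR R).
Proof.
move=> _ Y mY; rewrite setTI; apply: sub_sigma_algebra => /=.
rewrite -bigcup_seq/=; exists i => /=; first by rewrite mem_index_enum.
by exists Y => //; rewrite setTI.
Qed.

Lemma measurable_fun_rV d0 (T : measurableType d0) (f : T -> 'rV[R]_d) :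
  (forall i, measurable_fun [set: T] (fun x => f x 0 i : measurableTypeR R)) ->
  measurable_fun [set: T] f.
Proof.
move=> mf _ Y; rewrite setTI.
pose F : set (set 'rV[R]_d) := image_set_system setT f measurable.
suff : g_sigma_preimage coord `<=` F.
  by move=> H /H; rewrite /F/image_set_system/= setTI.
apply: smallest_sub.
  exact: (@sigma_algebra_image _ _ setT f measurable (sigma_algebra_measurable T)).
rewrite -bigcup_seq/=; apply: bigcup_sub => i _ A [B mB <-].
rewrite /F /image_set_system /= !setTI.
by have := mf i measurableT B mB; rewrite setTI.
Qed.

End rV_measurable.

(* Lebesgue measure on R^n: the image of leb (n-1) \x lebesgue_measure under  *)
(* the identification of R^(n-1) * R with R^n.                                *)
Section lebesgue_rV.
Context (R : realType).

Definition snoc_rV n (p : 'rV[R]_n * measurableTypeR R) : 'rV[R]_n.+1 :=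
  \row_i (if unlift ord_max i is Some j then p.1 0 j else p.2).

Lemma measurable_snoc_rV n : measurable_fun setT (@snoc_rV n).
Proof.
apply: measurable_fun_rV => i.
rewrite /snoc_rV; case: (unliftP ord_max i) => [j|] ij.
  rewrite (_ : (fun _ => _) =
    (fun x : 'rV[R]_n => x 0 j : measurableTypeR R) \o fst).
    exact: measurableT_comp (measurable_coord j) measurable_fst.
  by apply/funext => x /=; rewrite mxE ij liftK.
rewrite (_ : (fun _ => _) = snd); first exact: measurable_snd.
by apply/funext => x /=; rewrite mxE ij unlift_none.
Qed.

Section step.
Context n (mu : {measure set 'rV[R]_n -> \bar R}).

Definition leb_snoc : set 'rV[R]_n.+1 -> \bar R :=
  pushforward (mu \x @lebesgue_measure R)%E (@snoc_rV n).

HB.instance Definition _ := Measure.copy leb_snoc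
  (@measure_function_pushforward__canonical__measure_function_Measure
    _ _ _ _ _ (mu \x @lebesgue_measure R)%E _ (@measurable_snoc_rV n)).

End step.

Fixpoint leb n : {measure set 'rV[R]_n -> \bar R} :=
  if n is m.+1 then leb_snoc (leb m) else dirac (0 : 'rV[R]_0).

End lebesgue_rV.

(* Anti-dual of a subspace S of X for the (semi)norm N, and its dual norm.    *)
Section antidual.
Context (R : realType) (X : lmodType R[i]).
Implicit Types (S : set X) (N : X -> R) (F : X -> R[i]).

Definition linear_subspace S :=
  S 0 /\ forall (c : R[i]) u v, S u -> S v -> S (c *: u + v).

Definition antidual S N F :=
  (forall (c : R[i]) u v, S u -> S v -> F (c *: u + v) = conjc c * F u + F v) /\
  (exists M : R, forall u, S u -> normc (F u) <= M * N u).

Definition dual_norm S N F : R :=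
  sup [set normc (F u) | u in [set u | S u /\ N u <= 1]].

End antidual.

(* A Sobolev function is carried together with its weak gradient. The fields  *)
(* are representatives: equality in H^1(O) is h1norm O (u - v) = 0.           *)
Notation sobolev R d :=
  (('rV[R]_d -> R[i]^o) * ('I_d -> 'rV[R]_d -> R[i]^o))%type.

Section space.
Context (R : realType) (d : nat).
Local Notation C := R[i].
Local Notation E := 'rV[R]_d.
Local Notation W := (sobolev R d).

Definition enorm (x : E) : R := Num.sqrt (\sum_i (x 0 i) ^+ 2).
Definition eball (r : R) : set E := [set x | enorm x < r].
Definition sphere (r : R) : set E := [set x | enorm x = r].
Definition exterior (r : R) : set E := [set x | r < enorm x].
Definition annulus (r r' : R) : set E := [set x | r < enorm x < r'].

(* Evans' definition: near each boundary point, D lies strictly above the     *)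
(* graph of a Lipschitz function of d - 1 coordinates, in some orthonormal    *)
(* system (given by Q).                                                       *)
Definition bounded_lipschitz_domain (D : set E) :=
  [/\ open D, connected D, D !=set0, bounded_set D &
   forall x : E, (closure D `\` D) x ->
   exists (r : R) (Q : 'M[R]_d) (i0 : 'I_d) (phi : E -> R),
   [/\ 0 < r, Q *m Q^T = 1%:M,
       (forall y z : E, (forall j, j != i0 -> y 0 j = z 0 j) -> phi y = phi z),
       lipschitz (phi : E -> R^o) &
       forall y : E, enorm (y - x) < r ->
         (D y <-> phi (y *m Q) < (y *m Q) 0 i0)]].

Definition cmeasurable (D : set E) (f : E -> C) :=
  measurable_fun D (fun x => complex.Re (f x)) /\ measurable_fun D (fun x => complex.Im (f x)).

Definition cint (D : set E) (f : E -> C) : C :=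
  (\int[leb R d]_(x in D) complex.Re (f x)) +i* (\int[leb R d]_(x in D) complex.Im (f x)).

Definition l2sq (D : set E) (f : E -> C) : R :=
  \int[leb R d]_(x in D) (normc (f x) ^+ 2).

Definition L2 (D : set E) (f : E -> C) :=
  cmeasurable D f /\
  (\int[leb R d]_(x in D) ((normc (f x) ^+ 2)%:E) < +oo)%E.

Definition Lp (p : \bar R) (D : set E) (f : E -> R) : \bar R :=
  Lnorm (leb R d) p (EFin \o (f \_ D)).

Definition partial (i : 'I_d) (f : E -> R) (x : E) : R :=
  'D_(delta_mx 0 i) (f : E -> R^o) x.

Fixpoint Ck (k : nat) (O : set E) (f : E -> R) : Prop :=
  (forall x, O x -> {for x, continuous f}) /\
  (if k is k'.+1 then
     forall i, (forall x, O x -> derivable (f : E -> R^o) x (delta_mx 0 i)) /\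
               Ck k' O (partial i f)
   else True).

Definition cCk (k : nat) (O : set E) (w : E -> C) :=
  Ck k O (fun x => complex.Re (w x)) /\ Ck k O (fun x => complex.Im (w x)).

Definition cpartial (i : 'I_d) (w : E -> C) (x : E) : C :=
  partial i (fun y => complex.Re (w y)) x +i* partial i (fun y => complex.Im (w y)) x.

Definition with_grad (w : E -> C) : W := (w, fun i => cpartial i w).

Definition radial_deriv (w : E -> C) (x : E) : C :=
  \sum_i (x 0 i / enorm x)%:C * cpartial i w x.

Definition test_function (O : set E) (phi : E -> R) :=
  (forall k, Ck k setT phi) /\
  exists K : set E, [/\ compact K, K `<=` O & forall x, ~ K x -> phi x = 0].

Definition H1 (O : set E) : set W := [set u |
  [/\ L2 O u.1, forall i, L2 O (u.2 i) &
      forall i phi, test_function O phi ->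
        cint O (fun x => u.1 x * (partial i phi x)%:C) =
        - cint O (fun x => u.2 i x * (phi x)%:C)]].

Definition h1norm (O : set E) (u : W) : R :=
  Num.sqrt (l2sq O u.1 + \sum_i l2sq O (u.2 i)).

(* Surface integrals over Gamma_r, from polar coordinates:                    *)
(* int_{Gamma_r} f ds = (d / r) int_{B_r} f(r x / |x|) dx.                    *)
Definition from_sphere (r : R) (f : E -> C) (x : E) : C :=
  f ((r / enorm x) *: x).

Definition surf_int (r : R) (f : E -> C) : C :=
  (d%:R / r)%:C * cint (eball r) (from_sphere r f).

Definition surf_L2 (r : R) (f : E -> C) := L2 (eball r) (from_sphere r f).

Definition surf_l2norm (r : R) (f : E -> C) : R :=
  Num.sqrt ((d%:R / r) * l2sq (eball r) (from_sphere r f)).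

(* g is the trace on Gamma_r of u in H^1(O), for O = B_r or O an annulus with *)
(* inner boundary Gamma_r: L^2-limit of the restrictions to Gamma_r of smooth *)
(* functions on R^d converging to u in H^1(O).                                *)
Definition has_trace (r : R) (O : set E) (u : W) (g : E -> C) :=
  [/\ H1 O u, surf_L2 r g &
   exists phi : nat -> E -> C,
   [/\ (forall m k, cCk k setT (phi m)),
       (fun m => h1norm O (u - with_grad (phi m))) @ \oo --> (0 : R) &
       (fun m => surf_l2norm r (fun x => g x - phi m x)) @ \oo --> (0 : R)]].

Definition trace (r : R) (u : W) : E -> C^o :=
  xget (fun=> 0) [set g | has_trace r (eball r) u g].

(* H^{1/2}(Gamma_r) = gamma(H^1(B_r)) with the quotient norm.                 *)
Definition Hhalf (r : R) : set (E -> C^o) :=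
  [set g | exists u, has_trace r (eball r) u g].

Definition hhalf_norm (r : R) (g : E -> C^o) : R :=
  inf [set h1norm (eball r) u | u in [set u | has_trace r (eball r) u g]].

(* w solves the exterior problem: classical in |x| > r, H^1 up to Gamma_r,    *)
(* with trace g, and radiating (uniformly in x / |x|).                        *)
Definition exterior_solution (r k : R) (g w : E -> C^o) :=
  [/\ cCk 2 (exterior r) w,
      (forall x, exterior r x ->
         \sum_i cpartial i (cpartial i w) x + (k ^+ 2)%:C * w x = 0),
      (forall r', r < r' -> has_trace r (annulus r r') (with_grad w) g) &
      forall eps : R, 0 < eps -> exists r0 : R, forall x : E,
        r < enorm x -> r0 < enorm x ->
        (enorm x) `^ ((d%:R - 1) / 2) *
          normc (radial_deriv w x - (0 +i* k) * w x) < eps].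

(* F in H^{-1/2}(Gamma_r) is the normal derivative (nu pointing out of B_r)   *)
(* of the exterior Helmholtz solution w, in the sense of Green's formula:     *)
(* <F, gamma phi> = - int_{|x| > r} (grad w . grad phi^* - k^2 w phi^* )      *)
(* for phi in H^1(|x| > r) vanishing for large |x|.                           *)
Definition normal_deriv (r k : R) (w : E -> C^o) (F : (E -> C^o) -> C) :=
  antidual (Hhalf r) (hhalf_norm r) F /\
  forall (r' : R) (phi : W) (psi : E -> C^o),
    r < r' -> H1 (exterior r) phi ->
    (forall x, r' <= enorm x -> phi.1 x = 0 /\ forall i, phi.2 i x = 0) ->
    has_trace r (annulus r r') phi psi ->
    F psi = - cint (exterior r) (fun x =>
      \sum_i cpartial i w x * conjc (phi.2 i x) - (k ^+ 2)%:C * w x * conjc (phi.1 x)).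

Definition DtN (r k : R) (g : E -> C^o) : (E -> C^o) -> C^o :=
  xget (fun=> 0) [set F | exists w,
    exterior_solution r k g w /\ normal_deriv r k w F].

(* The DtN map is well defined, and bounded from H^{1/2} to H^{-1/2}.         *)
Definition DtN_bounded (r k : R) :=
  [/\ (forall g, Hhalf r g -> exists w,
        [/\ exterior_solution r k g w, normal_deriv r k w (DtN r k g) &
            forall w', exterior_solution r k g w' ->
              forall x, exterior r x -> w' x = w x]),
      (forall (c : C) g g' psi, Hhalf r g -> Hhalf r g' -> Hhalf r psi ->
        DtN r k (c *: g + g') psi = c * DtN r k g psi + DtN r k g' psi) &
      exists M : R, forall g, Hhalf r g ->
        dual_norm (Hhalf r) (hhalf_norm r) (DtN r k g) <= M * hhalf_norm r g].

Definition index_profile (r : R) (D : set E) (nmin nmax : R) (n : E -> R) :=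
  [/\ measurable_fun (eball r) n,
      {ae leb R d, forall x, eball r x -> nmin <= n x <= nmax} &
      {ae leb R d, forall x, eball r x -> ~ closure D x -> n x = 1}].

Definition nonlinear_coeff (D : set E) (chi : E -> R) :=
  [/\ measurable_fun setT chi, (Lp +oo setT chi < +oo)%E,
      {ae leb R d, forall x, 0 <= chi x} &
      {ae leb R d, forall x, ~ closure D x -> chi x = 0}].

Definition linf_norm (r : R) (chi : E -> R) : R := fine (Lp +oo (eball r) chi).

Definition product_constant (r Cprod : R) := forall w z phi : W,
  H1 (eball r) w -> H1 (eball r) z -> H1 (eball r) phi ->
  (Lp 4%:E (eball r) (fun x => normc (w.1 x)) *
   Lp 4%:E (eball r) (fun x => normc (z.1 x)) *
   Lp 2%:E (eball r) (fun x => normc (phi.1 x)) <=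
   (Cprod * h1norm (eball r) w * h1norm (eball r) z * h1norm (eball r) phi)%:E)%E.

Definition helmholtz_form (r k : R) (n : E -> R) (w xi : W) : C :=
  cint (eball r) (fun x =>
    \sum_i w.2 i x * conjc (xi.2 i x) - (k ^+ 2 * n x)%:C * w.1 x * conjc (xi.1 x))
  - DtN r k (trace r w) (trace r xi).

Definition uinc (k : R) (d0 : E) (x : E) : C^o :=
  let t := k * \sum_i d0 0 i * x 0 i in cos t +i* sin t.

Definition ell (r k : R) (d0 : E) (xi : W) : C :=
  surf_int r (fun x => radial_deriv (uinc k d0) x * conjc (trace r xi x))
  - DtN r k (trace r (with_grad (uinc k d0))) (trace r xi).

(* Linear variational problems over a subspace S of V = H^1(B_r). In these    *)
(* definitions a w is the functional A w.                                     *)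
Section linear_problems.
Context (r : R).
Local Notation V := (H1 (eball r)).
Local Notation N := (h1norm (eball r)).
Implicit Types (S : set W) (a : W -> W -> C) (g : W -> C).

Definition solves S a g (w : W) := S w /\ forall phi, S phi -> a w phi = g phi.

Definition uniquely_solvable S a g :=
  exists w, solves S a g w /\ forall w', solves S a g w' -> N (w' - w) = 0.

Definition isomorphism_with_bound a (M : R) :=
  [/\ (forall w, V w -> antidual V N (a w)),
      (forall (c : C) w w' phi, V w -> V w' -> V phi ->
         a (c *: w + w') phi = c * a w phi + a w' phi),
      (exists M' : R, forall w, V w -> dual_norm V N (a w) <= M' * N w),
      (forall g, antidual V N g -> uniquely_solvable V a g) &
      forall g w, antidual V N g -> solves V a g w -> N w <= M * dual_norm V N g].

Definition discretely_stable S a (Mlin : R) := forall g, antidual S N g ->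
  uniquely_solvable S a g /\
  forall w, solves S a g w -> N w <= Mlin * dual_norm S N g.

Definition best_approx S (u : W) : R := inf [set N (u - z) | z in S].

Definition quasi_optimal S a (Cqo : R) := forall g w wh, antidual V N g ->
  solves V a g w -> solves S a g wh -> N (w - wh) <= Cqo * best_approx S w.

Definition nonlinear_solution S (a1 a2 : W -> W -> C) (l : W -> C)
    (chi1 chi2 : E -> R) (u1 u2 : W) :=
  solves S a1 (fun xi =>
    cint (eball r) (fun x => (chi1 x)%:C * conjc (u1.1 x) * u2.1 x * conjc (xi.1 x))
    + l xi) u1 /\
  solves S a2 (fun eta =>
    cint (eball r) (fun x => (chi2 x)%:C * (u1.1 x) ^+ 2 * conjc (eta.1 x))) u2.

End linear_problems.

(* An element K is given by its parametrization by the reference simplex      *)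
(* (extended to all of R^d).                                                  *)
Record mesh := Mesh { nelt : nat; elt : 'I_nelt -> E -> E }.

Definition barycentric (x : E) (j : 'I_d.+1) : R :=
  if unlift ord0 j is Some i then x 0 i else 1 - \sum_i x 0 i.

Definition simplex : set E := [set x | forall j, 0 <= barycentric x j].

Definition face (J : {set 'I_d.+1}) : set E :=
  [set x | simplex x /\ forall j, j \notin J -> barycentric x j = 0].

(* J = set0 gives the empty face.                                             *)
Definition conforming_mesh (r : R) (T : mesh) :=
  [/\ (forall t : 'I_(nelt T),
        [/\ forall i, Ck 1 setT (fun x => elt t x 0 i),
            (forall x y, simplex x -> simplex y -> elt t x = elt t y -> x = y) &
            forall x, simplex x ->
              \matrix_(i, j) partial i (fun y => elt t y 0 j) x \in unitmx]),
      (forall t : 'I_(nelt T), (elt t @` simplex) `&` sphere r = set0 ->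
        exists (A : 'M[R]_d) (b : E),
          forall x, simplex x -> elt t x = x *m A + b),
      \bigcup_(t in [set: 'I_(nelt T)]) (elt t @` simplex)
        = [set x | enorm x <= r] &
      forall t t' : 'I_(nelt T), t != t' ->
        exists J J' : {set 'I_d.+1}, [/\ J != [set: 'I_d.+1]%SET,
          J' != [set: 'I_d.+1]%SET,
          (elt t @` simplex) `&` (elt t' @` simplex) = elt t @` face J &
          elt t @` face J = elt t' @` face J']].

(* Every element is contained, up to the factor c, in the size of a ball that *)
(* it contains.                                                               *)
Definition shape_regular (c : R) (T : mesh) := forall t : 'I_(nelt T),
  exists (x : E) (rho : R),
  [/\ 0 < rho, [set y | enorm (y - x) <= rho] `<=` elt t @` simplex &
      forall y z, (elt t @` simplex) y -> (elt t @` simplex) z ->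
        enorm (y - z) <= c * rho].

Definition polynomial_of_degree (p : nat) (f : E -> C) :=
  exists c : {ffun 'I_d -> 'I_p.+1} -> C, forall x : E,
    f x = \sum_(m : {ffun 'I_d -> 'I_p.+1} | (\sum_i m i <= p)%N)
            c m * (\prod_i (x 0 i) ^+ m i)%:C.

(* On a curved element, polynomial means polynomial in the reference variable.*)
Definition fe_space (r : R) (p : nat) (T : mesh) (S : set W) :=
  [/\ linear_subspace S, S `<=` H1 (eball r),
      (exists (m : nat) (b : 'I_m -> W), (forall i, S (b i)) /\
        forall v, S v -> exists c : 'I_m -> C,
          h1norm (eball r) (v - \sum_i c i *: b i) = 0) &
      forall v, S v -> forall t : 'I_(nelt T), exists q : E -> C,
        polynomial_of_degree p q /\
        {ae leb R d, forall x, simplex x -> v.1 (elt t x) = q x}].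

End space.

(* Main.v *)
Require Import Defs.
From HB Require Import structures.
From mathcomp Require Import all_boot all_order all_algebra.
From mathcomp Require Import all_classical all_reals all_analysis.
From mathcomp Require Import measurable_realfun ess_sup_inf.
From mathcomp.real_closed Require Import complex.
From mathcomp Require Import ring lra.
Set Implicit Arguments.
Unset Strict Implicit.
Unset Printing Implicit Defensive.
Import Order.TTheory GRing.Theory Num.Theory numFieldNormedType.Exports.
Local Open Scope classical_set_scope.
Local Open Scope ring_scope.

(** Write e_j for the V-norm of u_j - u_jh and b_j for the best approximation
    error of u_j in V_h. Each u_j solves a linear problem whose right-hand side
    is the nonlinear source evaluated at (u1, u2). Solving the same linear
    problem in V_h gives a linear Galerkin projection R_j, and u_j - u_jh splits
    as (u_j - R_j) + (R_j - u_jh). Quasi-optimality bounds the first part by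
    Cqo b_j. The second part lies in V_h and solves a discrete linear problem
    driven by the difference of the exact and the discrete sources, so discrete
    stability bounds it by Mlin times the dual norm of that difference
    ([galerkin_perturbation]).

    The sources are quadratic and telescope: with tau the conjugation (first
    equation) or the identity (second equation),
      tau(u) v - tau(u') v' = tau(u - u') v + tau(u') (v - v').
    Hoelder's inequality with exponents (4, 4, 2), the product constant and the
    supremum bound of chi estimate each term ([trilinear_le],
    [source_diff_le]). On the balls of radii rho and sigma_rho this yields
      e_1 <= Cqo b_1 + theta e_1 + alpha e_2,   e_2 <= Cqo b_2 + beta e_1,
    and inserting the second inequality in the first one leaves
    (1 - q) e_1 <= Cqo (b_1 + alpha b_2), which is the contraction argument of
    [coupled_error_le].

    These estimates apply to differences of solutions, so H^1 of the ball must
    be closed under linear combinations. For the weak derivatives this needs the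
    products of L^2 functions with test functions to be integrable, that is, the
    Borel measurability of continuous functions for the sigma-algebra generated
    by the coordinates, and the finite volume of the ball. *)

(** * Complex numbers and square roots *)

Section complex_modulus.
Context (R : realType).
Local Notation C := R[i].
Implicit Types (x y : C) (t : R).

Lemma normc_ge0 x : 0 <= normc x.
Proof. by case: x => a b; exact: sqrtr_ge0. Qed.

Lemma normcD x y : normc (x + y) <= normc x + normc y.
Proof. by have /andP[_] := ComplexField.lec_normD x y. Qed.

Lemma normc_real t : normc t%:C%C = `|t|.
Proof. by rewrite /= expr0n /= addr0 sqrtr_sqr. Qed.

Lemma normc_conj x : normc (conjc x) = normc x.
Proof. by case: x => a b /=; rewrite sqrrN. Qed.

Lemma normc_sqr x : normc x ^+ 2 = complex.Re x ^+ 2 + complex.Im x ^+ 2.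
Proof. by case: x => a b /=; rewrite sqr_sqrtr ?addr_ge0 ?sqr_ge0. Qed.

Lemma normr_Re_le x : `|complex.Re x| <= normc x.
Proof.
by case: x => a b /=; rewrite -sqrtr_sqr ler_wsqrtr // lerDl sqr_ge0.
Qed.

Lemma normr_Im_le x : `|complex.Im x| <= normc x.
Proof.
by case: x => a b /=; rewrite -sqrtr_sqr ler_wsqrtr // lerDr sqr_ge0.
Qed.

Lemma dot_le_normc x y :
  complex.Re x * complex.Re y + complex.Im x * complex.Im y <= normc x * normc y.
Proof.
rewrite -(normc_conj x) -ComplexField.Normc.normcM.
apply: le_trans (normr_Re_le _); apply: le_trans (ler_norm _).
by case: x y => a b [c d] /=; rewrite mulNr opprK.
Qed.

(** The Peter-Paul form of the triangle inequality. It integrates termwise, so that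
    the triangle inequality of H^1 follows without a Cauchy-Schwarz inequality
    for integrals. *)
Lemma normc_sqrD_le t x y : 0 < t ->
  normc (x + y) ^+ 2 <= (1 + t) * normc x ^+ 2 + (1 + t^-1) * normc y ^+ 2.
Proof.
move=> t0; apply: (@le_trans _ _ ((normc x + normc y) ^+ 2)).
  by rewrite ler_sqr ?nnegrE ?addr_ge0 ?normc_ge0 ?normcD.
set a := normc x; set b := normc y.
rewrite -subr_ge0 [X in 0 <= X](_ : _ = (t * a - b) ^+ 2 / t).
  by rewrite divr_ge0 ?sqr_ge0 ?ltW.
by field; rewrite gt_eqF.
Qed.

End complex_modulus.

(** The infimum over t of (1 + t) X + (1 + 1/t) Y is the square of
    sqrt X + sqrt Y. *)
Lemma sqrt_subadditive (R : realType) (X Y Z : R) : 0 <= X -> 0 <= Y ->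
  (forall t, 0 < t -> Z <= (1 + t) * X + (1 + t^-1) * Y) ->
  Num.sqrt Z <= Num.sqrt X + Num.sqrt Y.
Proof.
move=> X0 Y0 H; apply/ler_addgt0Pr => e e0.
(* The infimum is approached at t = y / x, which degenerates when X or Y is 0;
   the shift by e / 2 keeps x and y positive. *)
set x := Num.sqrt X + e / 2; set y := Num.sqrt Y + e / 2.
have e20 : 0 < e / 2 by rewrite divr_gt0.
have x0 : 0 < x by rewrite /x ltr_wpDl ?sqrtr_ge0.
have y0 : 0 < y by rewrite /y ltr_wpDl ?sqrtr_ge0.
have -> : Num.sqrt X + Num.sqrt Y + e = x + y by rewrite /x /y; field.
have Xx : X <= x ^+ 2.
  by rewrite -{1}(sqr_sqrtr X0) ler_sqr ?nnegrE ?sqrtr_ge0 ?ltW // /x ltrDl.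
have Yy : Y <= y ^+ 2.
  by rewrite -{1}(sqr_sqrtr Y0) ler_sqr ?nnegrE ?sqrtr_ge0 ?ltW // /y ltrDl.
rewrite -(ger0_norm (addr_ge0 (ltW x0) (ltW y0))) -sqrtr_sqr ler_wsqrtr //.
have t0 : 0 < y / x by rewrite divr_gt0.
apply: (le_trans (H _ t0)).
have -> : (x + y) ^+ 2 = (1 + y / x) * x ^+ 2 + (1 + (y / x)^-1) * y ^+ 2.
  by field; rewrite !gt_eqF.
by apply: lerD; rewrite ler_wpM2l // addr_ge0 // ?invr_ge0 ltW.
Qed.

(** * Complex integrals and L^2 *)

Section complex_integral.
Context (R : realType) (d : nat).
Local Notation C := R[i].
Local Notation E := 'rV[R]_d.
Local Notation mu := (leb R d).
Context (D : set E) (mD : measurable D).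
Implicit Types (f g : E -> C).

Definition cintegrable f :=
  mu.-integrable D (EFin \o (fun x => complex.Re (f x))) /\
  mu.-integrable D (EFin \o (fun x => complex.Im (f x))).

Lemma cmeasurableD f g : cmeasurable D f -> cmeasurable D g ->
  cmeasurable D (fun x => f x + g x).
Proof.
move=> [f1 f2] [g1 g2]; split.
  rewrite (_ : (fun _ => _) = (fun x => complex.Re (f x) + complex.Re (g x))).
    exact: measurable_funD.
  by apply/funext => x; case: (f x) (g x) => [? ?] [].
rewrite (_ : (fun _ => _) = (fun x => complex.Im (f x) + complex.Im (g x))).
  exact: measurable_funD.
by apply/funext => x; case: (f x) (g x) => [? ?] [].
Qed.

Lemma cmeasurableM f g : cmeasurable D f -> cmeasurable D g ->
  cmeasurable D (fun x => f x * g x).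
Proof.
move=> [f1 f2] [g1 g2]; split.
  rewrite (_ : (fun _ => _) = (fun x => complex.Re (f x) * complex.Re (g x) -
                                       complex.Im (f x) * complex.Im (g x))).
    by apply: measurable_funB; exact: measurable_funM.
  by apply/funext => x; case: (f x) (g x) => [? ?] [].
rewrite (_ : (fun _ => _) = (fun x => complex.Re (f x) * complex.Im (g x) +
                                     complex.Im (f x) * complex.Re (g x))).
  by apply: measurable_funD; exact: measurable_funM.
by apply/funext => x; case: (f x) (g x) => [? ?] [].
Qed.

Lemma cmeasurable_conj f : cmeasurable D f -> cmeasurable D (fun x => conjc (f x)).
Proof.
move=> [f1 f2]; split.
  rewrite (_ : (fun _ => _) = (fun x => complex.Re (f x))) //.
  by apply/funext => x; case: (f x).
rewrite (_ : (fun _ => _) = (fun x => - complex.Im (f x))).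
  exact: measurable_funN.
by apply/funext => x; case: (f x).
Qed.

Lemma cmeasurable_real (r : E -> R) : measurable_fun D r ->
  cmeasurable D (fun x => (r x)%:C%C).
Proof. by move=> mr; split => //=; exact: measurable_cst. Qed.

Lemma cmeasurable_cst (c : C) : cmeasurable D (fun=> c).
Proof. by split; exact: measurable_cst. Qed.

Lemma measurable_normc_sqr f : cmeasurable D f ->
  measurable_fun D (fun x => normc (f x) ^+ 2).
Proof.
move=> [f1 f2].
rewrite (_ : (fun _ => _) = fun x => complex.Re (f x) ^+ 2 + complex.Im (f x) ^+ 2).
  by apply: measurable_funD; exact: measurable_funX.
by apply/funext => x; rewrite normc_sqr.
Qed.

Lemma measurable_normc f : cmeasurable D f -> measurable_fun D (fun x => normc (f x)).
Proof.
move=> /measurable_normc_sqr mf.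
rewrite (_ : (fun _ => _) = (fun t : R => t `^ 2^-1) \o fun x => normc (f x) ^+ 2).
  apply: measurableT_comp => //; exact: measurable_powR.
by apply/funext => x /=; rewrite powR12_sqrt ?sqr_ge0 // sqrtr_sqr ger0_norm ?normc_ge0.
Qed.

Lemma cintegrable_normc f : cmeasurable D f ->
  (\int[mu]_(x in D) (normc (f x))%:E < +oo)%E -> cintegrable f.
Proof.
move=> mf If.
have key (r : E -> R) : measurable_fun D r -> (forall x, `|r x| <= normc (f x)) ->
    mu.-integrable D (EFin \o r).
  move=> mr rf; apply/integrableP; split; first exact/measurable_EFinP.
  apply: le_lt_trans If; apply: ge0_le_integral => //=.
  - by do 2! apply: measurableT_comp => //.
  - by apply/measurable_EFinP; exact: measurable_normc.
  - by move=> x _; rewrite lee_fin.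
case: (mf) => m1 m2; split; apply: key => // x.
  exact: normr_Re_le.
exact: normr_Im_le.
Qed.

Lemma cintD f g : cintegrable f -> cintegrable g ->
  cint D (fun x => f x + g x) = cint D f + cint D g.
Proof.
move=> [f1 f2] [g1 g2]; rewrite /cint.
rewrite (_ : (fun _ => _) = (fun x => complex.Re (f x) + complex.Re (g x))); last first.
  by apply/funext => x; case: (f x) (g x) => [? ?] [].
rewrite (_ : (fun x => complex.Im _) = (fun x => complex.Im (f x) + complex.Im (g x))).
  by rewrite !RintegralD.
by apply/funext => x; case: (f x) (g x) => [? ?] [].
Qed.

Lemma cintZ c f : cintegrable f -> cint D (fun x => c * f x) = c * cint D f.
Proof.
case: c => a b [f1 f2]; rewrite /cint.
have i1 (r : R) : mu.-integrable D (EFin \o (fun x => r * complex.Re (f x))).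
  exact: (integrableZl mD r f1).
have i2 (r : R) : mu.-integrable D (EFin \o (fun x => r * complex.Im (f x))).
  exact: (integrableZl mD r f2).
rewrite (_ : (fun _ => _) = (fun x => a * complex.Re (f x) - b * complex.Im (f x))); last first.
  by apply/funext => x; case: (f x).
rewrite (_ : (fun x => complex.Im _) = (fun x => a * complex.Im (f x) + b * complex.Re (f x))).
  by rewrite RintegralB // RintegralD // !RintegralZl.
by apply/funext => x; case: (f x).
Qed.

(** The modulus of z = int f satisfies |z|^2 = int (Re z Re f + Im z Im f), whose
    integrand is at most |z| |f|. The right-hand side is +oo when f is not
    integrable. *)
Lemma normc_cint_le f : cmeasurable D f ->
  ((normc (cint D f))%:E <= \int[mu]_(x in D) (normc (f x))%:E)%E.
Proof.
move=> mf; have [->|] := eqVneq (\int[mu]_(x in D) (normc (f x))%:E)%E +oo%E.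
  by rewrite leey.
rewrite -ltey => If; have [f1 f2] := cintegrable_normc mf If.
have f3 : mu.-integrable D (EFin \o (fun x => normc (f x))).
  apply/integrableP; split; first by apply/measurable_EFinP; exact: measurable_normc.
  by under eq_integral => x _ do rewrite /= ger0_norm ?normc_ge0 //.
rewrite -[leRHS]fineK; last first.
  by rewrite ge0_fin_numE //; apply: integral_ge0 => x _; rewrite lee_fin normc_ge0.
rewrite lee_fin -/(Rintegral _ _ _).
set z := cint D f; set J := Rintegral _ _ _.
have J0 : 0 <= J by apply: Rintegral_ge0 => x _; exact: normc_ge0.
have [->|z0] := eqVneq (normc z) 0; first by [].
have {}z0 : 0 < normc z by rewrite lt_def z0 normc_ge0.
rewrite -(ler_pM2l z0) -expr2 normc_sqr !expr2 /=.
have g1 := integrableZl mD (complex.Re z) f1.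
have g2 := integrableZl mD (complex.Im z) f2.
rewrite -!RintegralZl // -RintegralD //.
apply: le_Rintegral => //.
- exact: integrableD g1 g2.
- exact: (integrableZl mD _ f3).
- by move=> x _; exact: (dot_le_normc z (f x)).
Qed.

Lemma cintegrableZ c f : cintegrable f -> cintegrable (fun x => c * f x).
Proof.
case: c => a b [f1 f2]; split.
  rewrite (_ : _ \o _ = ((fun x => a%:E * (complex.Re (f x))%:E) \-
     (fun x => b%:E * (complex.Im (f x))%:E))%E).
    exact: integrableB (integrableZl mD a f1) (integrableZl mD b f2).
  by apply/funext => x /=; rewrite -!EFinM -EFinB; case: (f x).
rewrite (_ : _ \o _ = ((fun x => a%:E * (complex.Im (f x))%:E) \+
     (fun x => b%:E * (complex.Re (f x))%:E))%E).
  exact: integrableD (integrableZl mD a f2) (integrableZl mD b f1).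
by apply/funext => x /=; rewrite -!EFinM -EFinD; case: (f x).
Qed.

Lemma cintegrableD f g : cintegrable f -> cintegrable g ->
  cintegrable (fun x => f x + g x).
Proof.
move=> [f1 f2] [g1 g2]; split.
  rewrite (_ : _ \o _ = ((fun x => (complex.Re (f x))%:E) \+
     (fun x => (complex.Re (g x))%:E))%E); first exact: integrableD.
  by apply/funext => x /=; rewrite -EFinD; case: (f x) (g x) => [? ?] [].
rewrite (_ : _ \o _ = ((fun x => (complex.Im (f x))%:E) \+
   (fun x => (complex.Im (g x))%:E))%E); first exact: integrableD.
by apply/funext => x /=; rewrite -EFinD; case: (f x) (g x) => [? ?] [].
Qed.

End complex_integral.

Section L2.
Context (R : realType) (d : nat).
Local Notation C := R[i].
Local Notation E := 'rV[R]_d.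
Local Notation mu := (leb R d).
Context (D : set E) (mD : measurable D).
Implicit Types (f g : E -> C).

Lemma integrable_normc_sqr f : L2 D f ->
  mu.-integrable D (EFin \o (fun x => normc (f x) ^+ 2)).
Proof.
move=> [mf If]; apply/integrableP; split.
  by apply/measurable_EFinP; apply: measurable_normc_sqr.
by under eq_integral => x _ do rewrite /= ger0_norm ?sqr_ge0 //.
Qed.

Lemma L2Z c f : L2 D f -> L2 D (fun x => c * f x).
Proof.
move=> Lf; split; first by apply: cmeasurableM Lf.1; exact: cmeasurable_cst.
have /integrableP[_] := integrableZl mD (normc c ^+ 2) (integrable_normc_sqr Lf).
under eq_integral => x _ do
  rewrite /= -exprMn -ComplexField.Normc.normcM ger0_norm ?sqr_ge0//.
by [].
Qed.

Lemma L2D f g : L2 D f -> L2 D g -> L2 D (fun x => f x + g x).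
Proof.
move=> Lf Lg; split; first exact: cmeasurableD Lf.1 Lg.1.
have /integrableP[mI] := integrableD mD
  (integrableZl mD (1 + 1) (integrable_normc_sqr Lf))
  (integrableZl mD (1 + 1^-1) (integrable_normc_sqr Lg)).
apply: le_lt_trans; apply: ge0_le_integral => //.
- by move=> x _; rewrite lee_fin sqr_ge0.
- by apply/measurable_EFinP; apply: measurable_normc_sqr; exact: cmeasurableD Lf.1 Lg.1.
- by apply: measurableT_comp.
- move=> x _; rewrite lee_fin.
  by apply: le_trans (ler_norm _); exact: normc_sqrD_le.
Qed.

Lemma l2sqD_le t f g : 0 < t -> L2 D f -> L2 D g ->
  l2sq D (fun x => f x + g x) <= (1 + t) * l2sq D f + (1 + t^-1) * l2sq D g.
Proof.
move=> t0 Lf Lg; rewrite /l2sq.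
have If := integrable_normc_sqr Lf; have Ig := integrable_normc_sqr Lg.
have Jf := integrableZl mD (1 + t) If; have Jg := integrableZl mD (1 + t^-1) Ig.
rewrite -!RintegralZl // -RintegralD //.
apply: le_Rintegral => //.
- exact: (integrable_normc_sqr (L2D Lf Lg)).
- exact: (integrableD mD Jf Jg).
- by move=> x _; exact: normc_sqrD_le.
Qed.

Lemma l2sq_ge0 f : 0 <= l2sq D f.
Proof. by apply: Rintegral_ge0 => x _; exact: sqr_ge0. Qed.

End L2.

(** * Borel sets and volume in R^d *)

Section borel_rV.
Context (R : realType) (d : nat).
Local Notation E := 'rV[R]_d.
Local Notation mu := (leb R d).

Lemma measurable_eball (r : R) : measurable (eball r : set E).
Proof.
have m : measurable_fun setT (@enorm R d).
  rewrite (_ : @enorm R d =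
    (fun t : R => t `^ 2^-1) \o (fun x : E => \sum_i (x 0 i) ^+ 2)).
    apply: measurableT_comp; first exact: measurable_powR.
    apply: measurable_sum => i; apply: measurable_funX; exact: measurable_coord.
  apply/funext => x /=; rewrite powR12_sqrt //.
  by apply: sumr_ge0 => i _; exact: sqr_ge0.
rewrite (_ : eball r = setT `&` @enorm R d @^-1` `]-oo, r[).
  by apply: m => //; exact: measurable_itv.
by apply/seteqP; split => x /=; rewrite in_itv //= => -[].
Qed.

Lemma measurable_rV_box (A : 'I_d -> set R) : (forall i, measurable (A i)) ->
  measurable [set x : E | forall i, A i (x 0 i)].
Proof.
move=> mA.
rewrite (_ : mkset _ = \bigcap_(i in setT) ((fun x : E => x 0 i) @^-1` A i)).
  apply: fin_bigcap_measurable => [|i _]; first exact: finite_finset.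
  rewrite -[X in measurable X]setTI; exact: (measurable_coord i measurableT (mA i)).
by apply/seteqP; split => [x H i _|x H i]; exact: H.
Qed.

Lemma measurable_rV_ball (x : E) (e : R) : 0 < e -> measurable (ball x e).
Proof.
move=> e0.
rewrite (_ : ball x e = [set y | forall i, ball (x 0 i) e (y 0 i)]).
  by apply: (@measurable_rV_box (fun i => ball (x 0 i) e)) => i; exact: measurable_ball.
apply/seteqP; split => y /=; first by move=> [_ H] i; exact: H.
by move=> H; split => // i j; rewrite (ord1 i); exact: H.
Qed.

(** R^d is second countable: an open set is the union of the cubes of rational
    centre and radius 1/(n+1) that it contains. *)
Lemma open_measurable_rV (U : set E) : open U -> measurable U.
Proof.
move=> oU.
pose Q (p : 'rV[rat]_d * nat) : set E := ball (map_mx ratr p.1 : E) p.2.+1%:R^-1.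
rewrite (_ : U = \bigcup_(p in [set p | Q p `<=` U]) Q p).
  rewrite bigcup_mkcond; apply: countable_bigcupT_measurable => // p.
  by case: ifP => // _; by apply: measurable_rV_ball; rewrite invr_gt0.
apply/seteqP; split => [x Ux|x [p /= + Qx]]; last exact.
have /nbhs_ballP[e /= e0 xU] := open_nbhs_nbhs (conj oU Ux).
have [n ne] : exists n, n.+1%:R^-1 < e / 2 :> R.
  exists (Num.trunc (e / 2)^-1).
  by rewrite -ltf_pV2 ?posrE ?invr_gt0 ?divr_gt0 // invrK truncnS_gt.
have n0 : 0 < n.+1%:R^-1 :> R by rewrite invr_gt0.
have H j : exists q : rat, `|x 0 j - ratr q| < n.+1%:R^-1 :> R.
  have /rat_in_itvoo[q] : x 0 j < x 0 j + n.+1%:R^-1 by rewrite ltrDl.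
  rewrite in_itv /= => /andP[xq qx]; exists q.
  by rewrite ltr0_norm ?subr_lt0 // opprB ltrBlDl.
have [q Hq] := choice H; exists (\row_j q j, n); last first.
  by split => // i j; rewrite (ord1 i) !mxE /ball /= distrC.
move=> y [_ Qy]; apply: xU; split => // i j; rewrite (ord1 i) /ball /=.
have := Qy 0 j; rewrite !mxE /ball /= => Hy.
have -> : x 0 j - y 0 j = (x 0 j - ratr (q j)) + (ratr (q j) - y 0 j) by ring.
by rewrite (le_lt_trans (ler_normD _ _)) // (splitr e) ltrD // (lt_trans _ ne).
Qed.

Lemma continuous_measurable_rV (f : E -> R) : continuous f ->
  measurable_fun setT (f : E -> measurableTypeR R).
Proof.
move=> /continuousP cf; apply: (measurability _ (RGenOpens.measurableE R)) => //.
move=> _ [_ [a [b ->] <-]]; rewrite setTI; apply: open_measurable_rV; apply: cf.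
exact: interval_open.
Qed.

End borel_rV.

Section finite_volume.
Context (R : realType).

Let measurable_closed_norm (r : R) : measurable [set t : R | `|t| <= r].
Proof.
rewrite (_ : mkset _ = `[- r, r]%classic); first exact: measurable_itv.
by apply/seteqP; split => t; rewrite /= in_itv /= ler_norml.
Qed.

Let box (n : nat) (r : R) : set 'rV[R]_n := [set x | forall i, `|x 0 i| <= r].
Arguments box : clear implicits.

Let measurable_box n (r : R) : measurable (box n r).
Proof. exact: (measurable_rV_box (fun=> measurable_closed_norm r)). Qed.

Lemma leb_box_lty n (r : R) : (leb R n (box n r) < +oo)%E.
Proof.
elim: n => [|n IH].
  by rewrite /leb /= diracE; case: (_ \in _); rewrite ltry.
rewrite /= /leb_snoc /pushforward.
rewrite (_ : _ @^-1` _ = box n r `*` `[- r, r]%classic).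
  rewrite product_measure1E //.
    have Ir : (@lebesgue_measure R `[(- r)%R, r]%classic < +oo)%E.
      by rewrite lebesgue_measure_itv; case: ifP; rewrite ?ltry // -EFinB ltry.
    by apply: lte_mul_pinfty Ir => //; rewrite ge0_fin_numE.
  exact: measurable_box.
apply/seteqP; split => [[x t]|[x t]].
  move=> /= H; split => /= [i|].
    by have := H (lift ord_max i); rewrite mxE liftK.
  by have := H ord_max; rewrite mxE unlift_none /= in_itv /= -?ler_norml.
move=> [/= Hx]; rewrite in_itv /= -?ler_norml => Ht i.
by rewrite mxE; case: unliftP => [j|] _.
Qed.

(** The ball lies in a cube, whose volume is computed by induction on the
    dimension from the product structure of the measure. *)
Lemma leb_eball_lty (d : nat) (r : R) : (leb R d (eball r) < +oo)%E.
Proof.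
apply: le_lt_trans (leb_box_lty d r).
apply: le_measure; rewrite ?inE; first exact: measurable_eball.
  exact: measurable_box.
move=> x /= xr i; apply: le_trans (ltW xr).
rewrite -sqrtr_sqr /enorm ler_wsqrtr // (bigD1 i) //= lerDl.
by apply: sumr_ge0 => j _; exact: sqr_ge0.
Qed.
End finite_volume.

(** * The space H^1 of the ball *)

Section H1_space.
Local Open Scope complex_scope.
Context (R : realType) (d : nat) (r : R).
Local Notation C := R[i].
Local Notation E := 'rV[R]_d.
Local Notation mu := (leb R d).
Local Notation B := (eball r : set E).
Local Notation V := (H1 B).
Local Notation N := (h1norm B).

Let mB : measurable B := measurable_eball r.

(** The ball lies in a closed cube, which is compact. *)
Lemma continuous_bounded_eball (f : E -> R) : continuous f ->
  exists M : R, 0 <= M /\ forall x, B x -> `|f x| <= M.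
Proof.
move=> cf.
have K : compact [set x : E | forall i, `[- r, r]%classic (x ord0 i)].
  by apply: (@rV_compact R d (fun=> `[- r, r]%classic)) => i; exact: segment_compact.
have /compact_bounded[M [_ HM]] := continuous_compact (continuous_subspaceT cf) K.
exists (`|M| + 1); split => [|x Bx]; first by rewrite addr_ge0.
apply: (HM (`|M| + 1)); first by rewrite ltr_pwDr // ler_norm.
exists x => // i; rewrite /= in_itv /= -ler_norml; apply: le_trans (ltW Bx).
rewrite -sqrtr_sqr /enorm ler_wsqrtr // (bigD1 i) //= lerDl.
by apply: sumr_ge0 => j _; exact: sqr_ge0.
Qed.

(** On a set of finite volume |u| <= 1 + |u|^2 makes L^2 functions integrable. *)
Lemma cintegrable_L2_bounded (u : E -> C) (g : E -> R) (M : R) :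
  L2 B u -> measurable_fun B g -> 0 <= M -> (forall x, B x -> `|g x| <= M) ->
  cintegrable B (fun x => u x * (g x)%:C).
Proof.
move=> Lu mg M0 gM.
have mug : cmeasurable B (fun x => u x * (g x)%:C).
  by apply: cmeasurableM Lu.1 _; exact: cmeasurable_real.
apply: cintegrable_normc => //.
have I1 : mu.-integrable B (EFin \o cst 1).
  apply/integrableP; split; first exact/measurable_EFinP.
  under eq_integral => x _ do rewrite /= normr1.
  by rewrite integral_cst // mul1e leb_eball_lty.
have IG := integrableZl mB M (integrableD mB I1 (integrable_normc_sqr Lu)).
apply: le_lt_trans (integrable_lty mB IG); apply: ge0_le_integral => //.
- by move=> x _; rewrite lee_fin normc_ge0.
- by apply/measurable_EFinP; exact: measurable_normc.
- exact: measurable_int IG.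
- move=> x Bx; rewrite lee_fin ComplexField.Normc.normcM normc_real mulrC.
  apply: ler_pM; rewrite ?normr_ge0 ?normc_ge0 ?gM //.
  by have := sqr_ge0 (normc (u x) - 1); rewrite sqrrB1 /=; have := normc_ge0 (u x); nra.
Qed.

Let L20 : L2 B (fun=> 0).
Proof.
split; first exact: cmeasurable_cst.
by under eq_integral => x _ do rewrite ComplexField.Normc.normc0 expr0n /=; rewrite integral0.
Qed.

Lemma H1_linear_subspace : linear_subspace V.
Proof.
split.
  split => [|i|i phi _]; [exact: L20 | exact: L20 |].
  have cint0 (g : E -> R) : cint B (fun x => 0 * (g x)%:C) = 0.
    rewrite /cint; under eq_Rintegral => x _ do rewrite mul0r /=.
    by under [X in _ +i* X]eq_Rintegral => x _ do rewrite mul0r /=; rewrite Rintegral_cst // mul0r.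
  by rewrite /= !cint0 oppr0.
move=> c u v [Lu Lu' du] [Lv Lv' dv]; split.
- exact: (L2D mB (L2Z mB c Lu) Lv).
- move=> i; exact: (L2D mB (L2Z mB c (Lu' i)) (Lv' i)).
move=> i phi tphi; have [Cphi _] := tphi.
have bounded_meas (g : E -> R) : continuous g ->
    forall w, L2 B w -> cintegrable B (fun x => w x * (g x)%:C).
  move=> cg w Lw; have [M [M0 gM]] := continuous_bounded_eball cg.
  apply: cintegrable_L2_bounded Lw _ M0 gM.
  by apply: measurable_funTS; exact: continuous_measurable_rV.
have c0 : continuous phi by move=> x; exact: (Cphi 0%N).1.
have c1 : continuous (partial i phi).
  by have [_ /(_ i)[_ [H _]]] := Cphi 1%N => x; exact: H.
have split_cint (w w' : E -> C) (g : E -> R) : continuous g -> L2 B w -> L2 B w' ->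
    cint B (fun x => (c * w x + w' x) * (g x)%:C) =
    c * cint B (fun x => w x * (g x)%:C) + cint B (fun x => w' x * (g x)%:C).
  move=> cg Lw Lw'; have Iw := bounded_meas _ cg _ Lw; have Iw' := bounded_meas _ cg _ Lw'.
  rewrite -(cintZ mB c Iw) -(cintD mB (cintegrableZ mB c Iw) Iw').
  by congr cint; apply/funext => x; rewrite mulrDl mulrA.
rewrite (split_cint _ _ _ c1 Lu Lv) (split_cint _ _ _ c0 (Lu' i) (Lv' i)).
by rewrite du // dv // mulrN opprD.
Qed.

Lemma h1norm_triangle u v : V u -> V v -> N (u + v) <= N u + N v.
Proof.
move=> [Lu Lu' _] [Lv Lv' _].
have ge0 w : 0 <= l2sq B w.1 + \sum_i l2sq B (w.2 i) :> R.
  by rewrite addr_ge0 ?sumr_ge0 // => *; exact: l2sq_ge0.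
apply: sqrt_subadditive => // t t0; rewrite !mulrDr !mulr_sumr addrACA -big_split /=.
apply: lerD; first exact: l2sqD_le.
by apply: ler_sum => i _; exact: l2sqD_le.
Qed.

Lemma h1norm0 : N 0 = 0.
Proof.
have l0 : l2sq B (fun=> 0) = 0.
  rewrite /l2sq; under eq_Rintegral => x _ do rewrite ComplexField.Normc.normc0 expr0n /=.
  by rewrite Rintegral_cst // mul0r.
by rewrite /h1norm l0 big1 ?addr0 ?sqrtr0.
Qed.

Lemma h1norm_ge0 u : 0 <= N u.
Proof. exact: sqrtr_ge0. Qed.

End H1_space.

(** * The trilinear estimate *)

Section hoelder442.
Context d (T : measurableType d) (R : realType) (mu : {measure set T -> \bar R}).
Local Notation "'N_ p [ f ]" := (Lnorm mu p (EFin \o f)).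
Local Open Scope ereal_scope.

(** Cauchy-Schwarz for f^2 and g^2, with the L^4 norm of f being the square root
    of the L^2 norm of f^2. *)
Lemma Lnorm2M_le (f g : T -> R) :
  measurable_fun setT f -> measurable_fun setT g ->
  'N_2%:E[(f \* g)%R] <= 'N_4%:E[f] * 'N_4%:E[g].
Proof.
move=> mf mg.
have half : (2^-1 + 2^-1 = 1 :> R)%R by lra.
have quarter : (4^-1 = 2^-1 * 2^-1 :> R)%R by lra.
have E4 (u : T -> R) : 'N_4%:E[u] = 'N_2%:E[(fun x => u x ^+ 2)%R] `^ 2^-1.
  rewrite unlock -poweRrM quarter; congr (_ `^ _); apply: eq_integral => x _ /=.
  by rewrite normrX -powR_mulrn // -powRrM; congr (_ `^ _)%:E; lra.
have E2 : 'N_2%:E[(f \* g)%R] = 'N_1[((fun x => f x ^+ 2) \* (fun x => g x ^+ 2))%R] `^ 2^-1.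
  rewrite Lnorm1 unlock; congr (_ `^ _); apply: eq_integral => x _ /=.
  by rewrite -exprMn normrX powR_mulrn.
rewrite E2 !E4 -poweRM ?Lnorm_ge0 //; apply: gt0_ler_poweR.
- by rewrite invr_ge0.
- by rewrite in_itv /= leey andbT Lnorm_ge0.
- by rewrite in_itv /= leey andbT mule_ge0 ?Lnorm_ge0.
- by apply: hoelder => //; exact: measurable_funX.
Qed.

Lemma hoelder_4_4_2 (f g h : T -> R) :
  measurable_fun setT f -> measurable_fun setT g -> measurable_fun setT h ->
  \int[mu]_x `|(f x * g x * h x)%:E| <= 'N_4%:E[f] * 'N_4%:E[g] * 'N_2%:E[h].
Proof.
move=> mf mg mh.
have half : (2^-1 + 2^-1 = 1 :> R)%R by lra.
have := hoelder mu (measurable_funM mf mg) mh (@ltr0Sn R 1) (@ltr0Sn R 1) half.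
rewrite Lnorm1 => /le_trans; apply.
by apply: lee_wpmul2r; [exact: Lnorm_ge0|exact: Lnorm2M_le].
Qed.

End hoelder442.

Section trilinear.
Local Open Scope complex_scope.
Context (R : realType) (d : nat) (r : R).
Local Notation C := R[i].
Local Notation E := 'rV[R]_d.
Local Notation mu := (leb R d).
Local Notation B := (eball r : set E).
Local Notation V := (H1 B).
Local Notation N := (h1norm B).
Local Notation W := (sobolev R d).

Let mB : measurable B := measurable_eball r.

Lemma linf_norm_ge0 (chi : E -> R) : 0 <= linf_norm r chi.
Proof. by apply: fine_ge0; exact: Lnorm_ge0. Qed.

(** [linf_norm] is the real part of an extended supremum and is a bound only once
    that supremum is known to be finite; finiteness is inherited from the whole
    space. The null measure is treated apart, since there [Lp +oo] is 0 by
    convention and every property holds almost everywhere. *)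
Lemma ae_le_linf_norm (D : set E) (chi : E -> R) : nonlinear_coeff D chi ->
  {ae mu, forall x, B x -> `|chi x| <= linf_norm r chi}.
Proof.
move=> [mchi chi_lty _ _].
have [mu0|mu0] := leP (mu setT) 0%E.
  exists setT; split => //.
  by apply/eqP; rewrite eq_le mu0 measure_ge0.
have sup_lty : (Lp +oo B chi < +oo)%E.
  apply: le_lt_trans chi_lty; rewrite /Lp unlock mu0.
  apply: le_ess_sup; apply: nearW => x /=.
  by rewrite /patch; case: ifP => _; rewrite ?normr0 ?in_setT lee_fin.
have := ess_sup_ge mu (abse \o (EFin \o (chi \_ B))).
have -> : ess_sup mu (abse \o (EFin \o (chi \_ B))) = (linf_norm r chi)%:E.
  rewrite /linf_norm fineK; first by rewrite /Lp unlock mu0.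
  by rewrite ge0_fin_numE // Lnorm_ge0.
apply: filterS => x /= + Bx.
by rewrite /patch mem_set // lee_fin.
Qed.

(** The product constant bounds a product of extended L^p norms which could be
    infinite separately; Hoelder's inequality in the extended reals covers that
    case as well. *)
Lemma integral_triple_le (Cprod : R) (u v w : W) : product_constant d r Cprod ->
  V u -> V v -> V w ->
  (\int[mu]_(x in B) (normc (u.1 x) * normc (v.1 x) * normc (w.1 x))%:E <=
   (Cprod * N u * N v * N w)%:E)%E.
Proof.
move=> HC Vu Vv Vw; apply: le_trans (HC _ _ _ Vu Vv Vw).
have m (z : W) : V z -> measurable_fun setT ((fun x => normc (z.1 x)) \_ B).
  by move=> [[mz _] _ _]; apply/(measurable_restrictT _ mB); exact: measurable_normc.
apply: le_trans (hoelder_4_4_2 mu (m _ Vu) (m _ Vv) (m _ Vw)).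
rewrite [leLHS]integral_mkcond le_eqVlt; apply/orP; left; apply/eqP.
apply: eq_integral => x _; rewrite /patch; case: ifP => _.
  by rewrite /= ger0_norm // !mulr_ge0 ?normc_ge0.
by rewrite mulr0 /= normr0.
Qed.

(** The factors f and g need only have the moduli of the H^1 functions u and v:
    this allows the complex conjugate of u as a factor. *)
Lemma trilinear_le (Cprod : R) (D : set E) (chi : E -> R) (f g : E -> C) (u v w : W) :
  product_constant d r Cprod -> nonlinear_coeff D chi ->
  V u -> V v -> V w ->
  cmeasurable B f -> (forall x, normc (f x) = normc (u.1 x)) ->
  cmeasurable B g -> (forall x, normc (g x) = normc (v.1 x)) ->
  let F x := (chi x)%:C * f x * g x * conjc (w.1 x) in
  cintegrable B F /\
  normc (cint B F) <= Cprod * linf_norm r chi * N u * N v * N w.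
Proof.
move=> HC Hchi Vu Vv Vw mf fu mg gv F.
have [mw _] : L2 B w.1 by case: Vw.
have mF : cmeasurable B F.
  apply: cmeasurableM; last exact: cmeasurable_conj.
  apply: cmeasurableM mg; apply: cmeasurableM mf; apply: cmeasurable_real.
  by apply: measurable_funTS; case: Hchi.
have IF : (\int[mu]_(x in B) (normc (F x))%:E <=
    (Cprod * linf_norm r chi * N u * N v * N w)%:E)%E.
  have -> : Cprod * linf_norm r chi * N u * N v * N w =
            linf_norm r chi * (Cprod * N u * N v * N w) by ring.
  have mt : measurable_fun B (fun x => normc (u.1 x) * normc (v.1 x) * normc (w.1 x)).
    have [[mu1 _] _ _] := Vu; have [[mv1 _] _ _] := Vv.
    by do 2?apply: measurable_funM; exact: measurable_normc.
  rewrite EFinM; apply: le_trans (lee_wpmul2l _ (integral_triple_le HC Vu Vv Vw)); last first.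
    by rewrite lee_fin linf_norm_ge0.
  rewrite -ge0_integralZl_EFin ?linf_norm_ge0 //; last 2 first.
  - by move=> x _; rewrite lee_fin !mulr_ge0 ?normc_ge0.
  - exact/measurable_EFinP.
  apply: ae_ge0_le_integral => //.
  - by move=> x _; rewrite lee_fin normc_ge0.
  - by apply/measurable_EFinP; exact: measurable_normc.
  - by move=> x _; rewrite -EFinM lee_fin !mulr_ge0 ?normc_ge0 ?linf_norm_ge0.
  - by apply/measurable_EFinP; apply: measurable_funM => //; exact: measurable_cst.
  apply: filterS (ae_le_linf_norm Hchi) => x chix Bx.
  rewrite -EFinM lee_fin !ComplexField.Normc.normcM normc_real normc_conj fu gv.
  by rewrite -!mulrA ler_wpM2r ?chix // !mulr_ge0 ?normc_ge0.
split; first by apply: cintegrable_normc => //; apply: le_lt_trans IF _; rewrite ltry.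
by rewrite -lee_fin; apply: le_trans IF; exact: normc_cint_le.
Qed.

End trilinear.

(** * The quadratic sources *)

Section quadratic_source.
Local Open Scope complex_scope.
Context (R : realType) (d : nat) (r Cprod : R).
Local Notation C := R[i].
Local Notation E := 'rV[R]_d.
Local Notation B := (eball r : set E).
Local Notation V := (H1 B).
Local Notation N := (h1norm B).
Local Notation W := (sobolev R d).
Context (HC : product_constant d r Cprod).
Context (D : set E) (chi : E -> R) (Hchi : nonlinear_coeff D chi).
Context (tau : C -> C).
Hypothesis tauD : forall x y, tau (x + y) = tau x + tau y.
Hypothesis normc_tau : forall x, normc (tau x) = normc x.
Hypothesis tau_meas : forall f : E -> C, cmeasurable B f -> cmeasurable B (tau \o f).

Let mB : measurable B := measurable_eball r.
Let Vlin : linear_subspace V := H1_linear_subspace d r.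

(** Both nonlinear right-hand sides have this form: [tau] is the conjugation and
    (u, v) = (u1, u2) in the first equation, [tau] is the identity and
    u = v = u1 in the second one. *)
Definition source (u v w : W) : C :=
  cint B (fun x => (chi x)%:C * tau (u.1 x) * v.1 x * conjc (w.1 x)).

Let source_le u v w : V u -> V v -> V w ->
  cintegrable B (fun x => (chi x)%:C * tau (u.1 x) * v.1 x * conjc (w.1 x)) /\
  normc (source u v w) <= Cprod * linf_norm r chi * N u * N v * N w.
Proof.
move=> Vu Vv Vw; have [[mu _] _ _] := Vu; have [[mv _] _ _] := Vv.
by apply: (trilinear_le HC Hchi Vu Vv Vw) => //; exact: tau_meas mu.
Qed.

Lemma source_antidual u v : V u -> V v -> antidual V N (source u v).
Proof.
move=> Vu Vv; split; last first.
  by exists (Cprod * linf_norm r chi * N u * N v) => w Vw; case: (source_le Vu Vv Vw).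
move=> c w w' Vw Vw'; have [I _] := source_le Vu Vv Vw; have [I' _] := source_le Vu Vv Vw'.
rewrite /source -(cintZ mB _ I) -(cintD mB (cintegrableZ mB _ I) I').
congr cint; apply/funext => x /=.
have -> : conjc (c * w.1 x + w'.1 x) = conjc c * conjc (w.1 x) + conjc (w'.1 x).
  by rewrite rmorphD rmorphM.
by rewrite mulrDr mulrCA.
Qed.

(** The difference telescopes: first u changes to u', then v to v'. *)
Lemma source_diff_le u v u' v' w : V u -> V v -> V u' -> V v' -> V w ->
  normc (source u v w - source u' v' w) <=
  Cprod * linf_norm r chi * (N (u - u') * N v + N u' * N (v - v')) * N w.
Proof.
move=> Vu Vv Vu' Vv' Vw.
have VB z z' : V z -> V z' -> V (z - z').
  by move=> Vz Vz'; rewrite addrC -scaleN1r; exact: Vlin.2.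
have [I1 b1] := source_le (VB _ _ Vu Vu') Vv Vw.
have [I2 b2] := source_le Vu' (VB _ _ Vv Vv') Vw.
have [I3 _] := source_le Vu' Vv' Vw.
have -> : source u v w = source u' v' w +
    (source (u - u') v w + source u' (v - v') w).
  rewrite /source -(cintD mB I1 I2) -(cintD mB I3 (cintegrableD mB I1 I2)).
  congr cint; apply/funext => x /=.
  have -> : tau (u.1 x) = tau (u.1 x - u'.1 x) + tau (u'.1 x) by rewrite -tauD subrK.
  have telescope (c a b z z' t : C) :
    c * (a + b) * z * t = c * b * z' * t + (c * a * z * t + c * b * (z - z') * t).
    by ring.
  exact: telescope.
rewrite addrC addrA addNr add0r; apply: le_trans (normcD _ _) _.
by apply: le_trans (lerD b1 b2) _; rewrite le_eqVlt; apply/orP; left; apply/eqP; ring.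
Qed.

End quadratic_source.

(** * Perturbed Galerkin problems *)

Section galerkin.
Context (R : realType) (d : nat) (r : R).
Local Notation C := R[i].
Local Notation E := 'rV[R]_d.
Local Notation B := (eball r : set E).
Local Notation V := (H1 B).
Local Notation N := (h1norm B).
Local Notation W := (sobolev R d).
Implicit Types (S : set W) (a : W -> W -> C) (g : W -> C).

Lemma antidual_sub S g : S `<=` V -> antidual V N g -> antidual S N g.
Proof.
move=> SV [lg [M gM]]; split; last by exists M => u /SV; exact: gM.
by move=> c u v /SV Vu /SV Vv; exact: lg.
Qed.

Lemma antidualD S g g' : antidual S N g -> antidual S N g' ->
  antidual S N (fun w => g w + g' w).
Proof.
move=> [lg [M gM]] [lg' [M' gM']]; split; last first.
  exists (M + M') => u Su; rewrite mulrDl.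
  by apply: le_trans (normcD _ _) _; apply: lerD; [exact: gM|exact: gM'].
by move=> c u v Su Sv; rewrite lg // lg' //; ring.
Qed.

Lemma antidualN S g : antidual S N g -> antidual S N (fun w => - g w).
Proof.
move=> [lg [M gM]]; split; last first.
  exists M => u Su; rewrite -mulN1r ComplexField.Normc.normcM.
  by rewrite -(rmorphN1 (real_complex R)) normc_real normrN1 mul1r gM.
by move=> c u v Su Sv; rewrite lg //; ring.
Qed.

Lemma dual_norm_le S g (M : R) : linear_subspace S -> 0 <= M ->
  (forall u, S u -> normc (g u) <= M * N u) -> dual_norm S N g <= M.
Proof.
move=> [S0 _] M0 gM; apply: ge_sup.
  by exists (normc (g 0)), 0 => //; split; rewrite // h1norm0 ler01.
by move=> _ [u [Su u1] <-]; rewrite (le_trans (gM _ Su)) // ler_piMr.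
Qed.

(** A lemma of Strang type: a Galerkin solution for a perturbed right-hand side
    differs from the exact one by the quasi-optimal error and by the stability
    constant times the perturbation, measured on S only. The perturbation is
    represented by g - a wh, which agrees with g - gh on S and is an antidual
    functional because a wh is. *)
Lemma galerkin_perturbation S a (M Mlin Cqo delta : R) g gh w wh :
  linear_subspace S -> S `<=` V -> isomorphism_with_bound r a M ->
  discretely_stable r S a Mlin -> quasi_optimal r S a Cqo ->
  0 <= Mlin -> 0 <= delta ->
  antidual V N g -> solves V a g w -> solves S a gh wh ->
  (forall phi, S phi -> normc (g phi - gh phi) <= delta * N phi) ->
  N (w - wh) <= Cqo * best_approx r S w + Mlin * delta.
Proof.
move=> Slin SV [a_dual a_lin _ _ _] stab qo Mlin0 delta0 g_dual sol solh gdelta.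
have [Vw _] := sol; have [Swh awh] := solh.
(* w' is the Galerkin solution for the unperturbed right-hand side. *)
have [[w' [solw' _]] _] := stab g (antidual_sub SV g_dual).
have [Sw' aw'] := solw'.
have VB z z' : V z -> V z' -> V (z - z').
  by move=> Vz Vz'; rewrite addrC -scaleN1r; exact: (H1_linear_subspace d r).2.
have -> : w - wh = (w - w') + (w' - wh) by rewrite addrA subrK.
apply: le_trans (h1norm_triangle (VB _ _ Vw (SV _ Sw')) (VB _ _ (SV _ Sw') (SV _ Swh))) _.
apply: lerD; first exact: qo g_dual sol solw'.
pose e phi := g phi + - a wh phi.
have e_dual : antidual S N e.
  apply: antidualD; first exact: antidual_sub g_dual.
  by apply: antidualN; apply: antidual_sub => //; apply: a_dual; exact: SV.
have sole : solves S a e (w' - wh).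
  split; first by rewrite addrC -scaleN1r; exact: Slin.2.
  move=> phi Sphi; rewrite addrC -scaleN1r a_lin; [|exact: SV..].
  by rewrite aw' // mulN1r addrC.
apply: le_trans ((stab e e_dual).2 _ sole) _; apply: ler_wpM2l => //.
by apply: dual_norm_le => // phi Sphi; rewrite /e awh //; exact: gdelta.
Qed.

End galerkin.

(** Inserting the second estimate in the first one leaves
    (1 - q) e1 <= E1 + alpha E2 with q = theta + alpha * beta, and
    E1 + alpha E2 <= (1 + alpha) (E1 + E2). *)
Lemma coupled_error_le (R : realType) (alpha beta theta E1 E2 e1 e2 : R) :
  0 <= alpha -> 0 <= beta -> 0 <= E1 -> 0 <= E2 -> theta + alpha * beta < 1 ->
  e1 <= E1 + theta * e1 + alpha * e2 -> e2 <= E2 + beta * e1 ->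
  e1 + e2 <=
  (1 + (1 + beta) * (1 + alpha) / (1 - (theta + alpha * beta))) * (E1 + E2).
Proof.
move=> a0 b0 E10 E20 q1 h1 h2; set q := theta + alpha * beta.
have q0 : 0 < 1 - q by rewrite subr_gt0.
have e1_le : e1 <= (1 + alpha) / (1 - q) * (E1 + E2).
  rewrite mulrAC ler_pdivlMr //.
  have := ler_wpM2l a0 h2; have := mulr_ge0 a0 E10; rewrite /q; lra.
have := ler_wpM2l (addr_ge0 (@ler01 R) b0) e1_le.
by rewrite -!mulrA mulrDl mul1r !mulrA; lra.
Qed.

(** * The error estimate *)

Theorem theorem3p8 (R : realType) (d : nat) (d_dim : d = 2%N \/ d = 3%N)
  (rad : R) (rad_gt0 : 0 < rad)
  (Cprod : R) (Cprod_gt0 : 0 < Cprod)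
  (Cprod_ineq : product_constant d rad Cprod)
  (D : set 'rV[R]_d) (D_lip : bounded_lipschitz_domain D)
  (D_ball : closure D `<=` eball rad)
  (kappa1 : R) (kappa1_gt0 : 0 < kappa1)
  (nmin nmax : R) (nmin_gt0 : 0 < nmin)
  (n1 n2 : 'rV[R]_d -> R)
  (n1_prof : index_profile rad D nmin nmax n1)
  (n2_prof : index_profile rad D nmin nmax n2)
  (chi1 chi2 : 'rV[R]_d -> R)
  (chi1_coeff : nonlinear_coeff D chi1)
  (chi2_coeff : nonlinear_coeff D chi2)
  (d0 : 'rV[R]_d) (d0_unit : enorm d0 = 1)
  (trace_ex : forall u : sobolev R d, H1 (eball rad) u ->
     has_trace rad (eball rad) u (trace rad u))
  (DtN_bd : forall k : R, 0 < k -> DtN_bounded d rad k) :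
  let V := @H1 R d (eball rad) in
  let norm := @h1norm R d (eball rad) in
  let kappa2 := 2 * kappa1 in
  let a1 := helmholtz_form rad kappa1 n1 in
  let a2 := helmholtz_form rad kappa2 n2 in
  let l := ell rad kappa1 d0 in
  antidual V norm l ->
  forall M1 M2 : R, 0 < M1 -> 0 < M2 ->
  isomorphism_with_bound rad a1 M1 ->
  isomorphism_with_bound rad a2 M2 ->
  forall (Th : R -> mesh R d)
    (Vh : R -> set (sobolev R d))
    (p : nat), (1 <= p)%N ->
  (forall h, 0 < h -> conforming_mesh rad (Th h)) ->
  (exists c : R, forall h, 0 < h -> shape_regular c (Th h)) ->
  (forall h, 0 < h -> fe_space rad p (Th h) (Vh h)) ->
  (forall v, V v -> best_approx rad (Vh h) v @[h --> 0^'+] --> (0 : R)) ->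
  forall h0 Mlin Cqo : R, 0 < h0 -> 0 < Mlin -> 0 < Cqo ->
  (forall h, 0 < h <= h0 ->
     [/\ discretely_stable rad (Vh h) a1 Mlin,
         discretely_stable rad (Vh h) a2 Mlin,
         quasi_optimal rad (Vh h) a1 Cqo &
         quasi_optimal rad (Vh h) a2 Cqo]) ->
  let Mhat1 := Num.max M1 Mlin in
  let Mhat2 := Num.max M2 Mlin in
  let alpha (r : R) := Mhat1 * Cprod * linf_norm rad chi1 * r in
  let beta (r : R) := 2 * Mhat2 * Cprod * linf_norm rad chi2 * r in
  let sigma (r : R) := beta r * r / 2 in
  let theta (r : R) := Mhat1 * Cprod * linf_norm rad chi1 * sigma r in
  let q (r : R) := theta r + alpha r * beta r in
  forall rho : R, 0 < rho ->
  Mhat1 * dual_norm V norm l + theta rho * rho <= rho ->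
  q rho < 1 ->
  let C_FE := Cqo * (1 + (1 + beta rho) * (1 + alpha rho) / (1 - q rho)) in
  forall h, 0 < h <= h0 ->
  forall u1 u2, nonlinear_solution rad V a1 a2 l chi1 chi2 u1 u2 ->
  norm u1 <= rho -> norm u2 <= sigma rho ->
  forall u1h u2h, nonlinear_solution rad (Vh h) a1 a2 l chi1 chi2 u1h u2h ->
  norm u1h <= rho -> norm u2h <= sigma rho ->
  norm (u1 - u1h) + norm (u2 - u2h) <=
    C_FE * (best_approx rad (Vh h) u1 + best_approx rad (Vh h) u2).
Proof.
move=> V norm kappa2 a1 a2 l l_dual M1 M2 M1_gt0 M2_gt0 iso1 iso2 Th Vh p p_ge1.
move=> _ _ fe _ h0 Mlin Cqo h0_gt0 Mlin_gt0 Cqo_gt0 discrete.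
move=> Mhat1 Mhat2 alpha beta sigma theta q rho rho_gt0 _ q_lt1 C_FE h hh0.
move=> u1 u2 [sol1 sol2] u1_le u2_le u1h u2h [sol1h sol2h] u1h_le u2h_le.
have [Slin SV _ _] : fe_space rad p (Th h) (Vh h) by apply: fe; case/andP: hh0.
have [stab1 stab2 qo1 qo2] := discrete h hh0.
have Vu1 : V u1 by case: sol1.
have Vu2 : V u2 by case: sol2.
have Vu1h : V u1h by apply: SV; case: sol1h.
have Vu2h : V u2h by apply: SV; case: sol2h.
have N0 u : 0 <= norm u by exact: h1norm_ge0.
have linf0 chi : 0 <= linf_norm rad chi by exact: linf_norm_ge0.
have Mlin_le1 : Mlin <= Mhat1 by rewrite le_max lexx orbT.
have Mlin_le2 : Mlin <= Mhat2 by rewrite le_max lexx orbT.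
have Mhat1_ge0 : 0 <= Mhat1 by rewrite (le_trans (ltW Mlin_gt0)).
have Mhat2_ge0 : 0 <= Mhat2 by rewrite (le_trans (ltW Mlin_gt0)).
have tau1 (x y : R[i]) : conjc (x + y) = conjc x + conjc y by exact: rmorphD.
have mid (f : 'rV[R]_d -> R[i]) : cmeasurable (eball rad) f ->
    cmeasurable (eball rad) (id \o f) by [].
set e1 := norm (u1 - u1h); set e2 := norm (u2 - u2h).
set b1 := best_approx rad (Vh h) u1; set b2 := best_approx rad (Vh h) u2.
have src1_dual : antidual V norm (source rad chi1 conjc u1 u2).
  exact (source_antidual Cprod_ineq chi1_coeff (@normc_conj R)
            (@cmeasurable_conj R d _) Vu1 Vu2).
have src2_dual : antidual V norm (source rad chi2 id u1 u1).
  exact: (source_antidual Cprod_ineq chi2_coeff (fun _ => erefl) mid Vu1 Vu1).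
have square S u w : solves S a2 (fun eta => cint (eball rad) (fun x =>
      (chi2 x)%:C%C * (u.1 x) ^+ 2 * conjc (eta.1 x))) w ->
    solves S a2 (source rad chi2 id u u) w.
  move=> [Sw a2w]; split => // eta Seta; rewrite a2w //.
  by congr cint; apply/funext => x; rewrite expr2 mulrA.
have e1_le : e1 <= Cqo * b1 + theta rho * e1 + alpha rho * e2.
  pose delta := Cprod * linf_norm rad chi1 * (e1 * norm u2 + norm u1h * e2).
  have delta_ge0 : 0 <= delta.
    by rewrite !mulr_ge0 ?addr_ge0 ?mulr_ge0 ?N0 ?linf0 // ltW.
  apply: (@le_trans _ _ (Cqo * b1 + Mlin * delta)).
    apply: (galerkin_perturbation Slin SV iso1 stab1 qo1 (ltW Mlin_gt0) delta_ge0
              (antidualD src1_dual l_dual) sol1 sol1h) => phi Sphi.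
    rewrite opprD addrACA subrr addr0.
    exact: (source_diff_le Cprod_ineq chi1_coeff tau1 (@normc_conj R)
              (@cmeasurable_conj R d _) Vu1 Vu2 Vu1h Vu2h (SV _ Sphi)).
  rewrite -addrA lerD2l.
  apply: (@le_trans _ _ (Mhat1 * (Cprod * linf_norm rad chi1 *
                                  (e1 * sigma rho + rho * e2)))).
    apply: ler_pM => //; first exact: ltW.
    apply: ler_wpM2l; first by rewrite mulr_ge0 // ltW.
    by apply: lerD; [apply: ler_wpM2l|apply: ler_wpM2r]; rewrite ?N0.
  by rewrite le_eqVlt; apply/orP; left; apply/eqP; rewrite /theta /alpha; ring.
have e2_le : e2 <= Cqo * b2 + beta rho * e1.
  pose delta := Cprod * linf_norm rad chi2 * (e1 * norm u1 + norm u1h * e1).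
  have delta_ge0 : 0 <= delta.
    by rewrite !mulr_ge0 ?addr_ge0 ?mulr_ge0 ?N0 ?linf0 // ltW.
  apply: (@le_trans _ _ (Cqo * b2 + Mlin * delta)).
    apply: (galerkin_perturbation Slin SV iso2 stab2 qo2 (ltW Mlin_gt0) delta_ge0
              src2_dual (square _ _ _ sol2) (square _ _ _ sol2h)) => phi Sphi.
    exact: (source_diff_le Cprod_ineq chi2_coeff (fun _ _ => erefl)
              (fun _ => erefl) mid Vu1 Vu1 Vu1h Vu1h (SV _ Sphi)).
  rewrite lerD2l.
  apply: (@le_trans _ _ (Mhat2 * (Cprod * linf_norm rad chi2 *
                                  (e1 * rho + rho * e1)))).
    apply: ler_pM => //; first exact: ltW.
    apply: ler_wpM2l; first by rewrite mulr_ge0 // ltW.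
    by apply: lerD; [apply: ler_wpM2l|apply: ler_wpM2r]; rewrite ?N0.
  by rewrite le_eqVlt; apply/orP; left; apply/eqP; rewrite /beta; ring.
have b_ge0 u : 0 <= best_approx rad (Vh h) u.
  apply: lb_le_inf => [|_ [z _ <-]]; last exact: h1norm_ge0.
  by exists (norm (u - 0)), 0 => //; exact: Slin.1.
have alpha_ge0 : 0 <= alpha rho by rewrite /alpha !mulr_ge0 ?linf0 // ltW.
have beta_ge0 : 0 <= beta rho by rewrite /beta !mulr_ge0 ?linf0 // ltW.
have Cqo_b u : 0 <= Cqo * best_approx rad (Vh h) u by rewrite mulr_ge0 // ltW.
have := coupled_error_le alpha_ge0 beta_ge0 (Cqo_b u1) (Cqo_b u2) q_lt1 e1_le e2_le.
by rewrite -mulrDr mulrCA mulrA.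
Qed.
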